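(* Let $n\ge 3$. For every pair of distinct indices $i,j\in\{1,\dots,n\}$, the recursively defined word $\tau_{ij}(a,b)$, evaluated at $a=a_n$, $b=b_n$, is exactly the elementary transvection $T_{i,j}$, i.e. $\tau_{ij}(a_n,b_n)=T_{i,j}$. In particular, $a_n,b_n$ generate $\mathrm{SL}_n(\mathbb Z)$.
   Context: $E_{i,j}$ denotes the standard $n\times n$ matrix unit, $T_{i,j}=I_n+E_{i,j}$ ($i\ne j$), and commutators are $[x,y]=x^{-1}y^{-1}xy$. Put $\varepsilon_n=(-1)^{n-1}$ and $$a_n=\sum_{i=1}^{n-1}E_{i,i+1}+\varepsilon_nE_{n,1},\qquad b_n=I_n+E_{2,1}.$$ The words $\tau_{ij}=\tau_{i,j}=\tau_{ij}(a,b)$ in the free group on $a,b$ ($1\le i\ne j\le n$) are defined as follows. Step 1: $\tau_{r+1,r}:=a^{-(r-1)}ba^{r-1}$ for $1\le r\le n-1$, and $\tau_{1n}:=\bigl(a^{-(n-1)}ba^{n-1}\bigr)^{\varepsilon_n}$. Step 2: for $d=2,\dots,n-1$ successively and all $i,j$ with $i-j=d$, $\tau_{ij}:=[\tau_{i,j+1},\tau_{j+1,j}]$. Step 3: for $2\le i\le n-1$, $\tau_{in}:=[\tau_{i1},\tau_{1n}]$. Step 4: for $1\le i<j\le n-1$, $\tau_{ij}:=[\tau_{in},\tau_{nj}]$. *)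

(* Defs.v *)
From HB Require Import structures.
From mathcomp Require Import all_boot all_order all_fingroup all_algebra.

Set Implicit Arguments.
Unset Strict Implicit.
Unset Printing Implicit Defensive.

Import GRing.Theory.

Local Open Scope ring_scope.

Section FreeGroup.

Variable X : choiceType.

(* The letter (x, true) stands for x and (x, false) for x^-1. *)
Definition letter : Type := (X * bool)%type.

Definition letter_inv (l : letter) : letter := (l.1, ~~ l.2).

Definition reduced (w : seq letter) : bool :=
  sorted (fun k l => l != letter_inv k) w.

Definition cons_red (l : letter) (w : seq letter) : seq letter :=
  if w is k :: w' then if k == letter_inv l then w' else l :: w else [:: l].

Definition reduce (w : seq letter) : seq letter := foldr cons_red [::] w.

Definition word_inv (w : seq letter) : seq letter := rev (map letter_inv w).

Lemma letter_invK : involutive letter_inv.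
Proof. by case=> x b; rewrite /letter_inv /= negbK. Qed.

Lemma cons_red_reduced l w : reduced w -> reduced (cons_red l w).
Proof.
rewrite /reduced; case: w => [|k w] //= kw; case: ifPn => [_|nkl] /=.
  exact: path_sorted kw.
by rewrite nkl.
Qed.

Lemma foldr_reduced u w : reduced w -> reduced (foldr cons_red w u).
Proof. by move=> rw; elim: u => //= l u; apply: cons_red_reduced. Qed.

Lemma reduce_reduced w : reduced (reduce w).
Proof. exact: foldr_reduced. Qed.

Lemma reduce_id w : reduced w -> reduce w = w.
Proof.
rewrite /reduced; elim: w => //= l w IHw lw; rewrite -/(reduce w).
rewrite IHw ?(path_sorted lw) //; case: w lw {IHw} => //= k w /andP[nkl _].
by rewrite (negPf nkl).
Qed.

Lemma cons_redK l w :
  reduced w -> cons_red (letter_inv l) (cons_red l w) = w.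
Proof.
rewrite /reduced; case: w => [|k w] /=; first by rewrite letter_invK eqxx.
case: eqP => [->|_] /=; last by rewrite letter_invK eqxx.
by case: w => //= m w /andP[/negPf-> _].
Qed.

Lemma foldr_reduce u w :
  reduced w -> foldr cons_red w (reduce u) = foldr cons_red w u.
Proof.
move=> rw; elim: u => //= l u <-; rewrite -/(reduce u).
have: reduced (reduce u) by exact: reduce_reduced.
case: (reduce u) => //= k v kv; case: eqP => //= ->.
by rewrite -{1}(letter_invK l) cons_redK // foldr_reduced.
Qed.

Lemma reduce_catl u v : reduce (reduce u ++ v) = reduce (u ++ v).
Proof. by rewrite /reduce !foldr_cat foldr_reduce // reduce_reduced. Qed.

Lemma reduce_catr u v : reduce (u ++ reduce v) = reduce (u ++ v).
Proof. by rewrite /reduce !foldr_cat -/(reduce _) reduce_id ?reduce_reduced. Qed.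

Lemma word_invK : involutive word_inv.
Proof.
by move=> w; rewrite /word_inv map_rev revK -map_comp (eq_map letter_invK) map_id.
Qed.

Lemma reduce_invl w : reduce (word_inv w ++ w) = [::].
Proof.
rewrite /reduce foldr_cat -/(reduce w).
suff H r : reduced r -> foldr cons_red (foldr cons_red r w) (word_inv w) = r.
  exact: H.
move=> rr; elim: w => //= l w IHw.
by rewrite /word_inv /= rev_cons foldr_rcons cons_redK ?foldr_reduced.
Qed.

Record free_group : Type :=
  FreeGroup { word_of :> seq letter; _ : reduced word_of }.

HB.instance Definition _ := [isSub for word_of].
HB.instance Definition _ := [Choice of free_group by <:].

Definition free_class (w : seq letter) : free_group :=
  FreeGroup (reduce_reduced w).

Definition free_one : free_group := free_class [::].
Definition free_mul (u v : free_group) : free_group :=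
  free_class (word_of u ++ word_of v).
Definition free_inv (u : free_group) : free_group :=
  free_class (word_inv (word_of u)).

Lemma word_ofK (u : free_group) : reduce (word_of u) = word_of u.
Proof. by rewrite reduce_id //; case: u. Qed.

Lemma free_mulA : associative free_mul.
Proof.
by move=> u v w; apply: val_inj; rewrite /= reduce_catr reduce_catl catA.
Qed.

Lemma free_mul1 : left_id free_one free_mul.
Proof. by move=> u; apply: val_inj; rewrite /= word_ofK. Qed.

Lemma free_mulr1 : right_id free_one free_mul.
Proof. by move=> u; apply: val_inj; rewrite /= cats0 word_ofK. Qed.

Lemma free_mulV : left_inverse free_one free_inv free_mul.
Proof. by move=> u; apply: val_inj; rewrite /= reduce_catl reduce_invl. Qed.

Lemma free_mulrV : right_inverse free_one free_inv free_mul.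
Proof.
move=> u; apply: val_inj; rewrite /= reduce_catr.
by rewrite -{1}[word_of u]word_invK reduce_invl.
Qed.

HB.instance Definition _ := isGroup.Build free_group
  free_mulA free_mul1 free_mulr1 free_mulV free_mulrV.

Definition free_gen (x : X) : free_group := free_class [:: (x, true)].

Variables (G : groupType) (f : X -> G).

Definition eval_letter (l : letter) : G := if l.2 then f l.1 else (f l.1)^-1%g.

Definition free_eval (u : free_group) : G :=
  (\prod_(l <- word_of u) eval_letter l)%g.

Lemma eval_letter_inv l : (eval_letter l * eval_letter (letter_inv l) = 1)%g.
Proof.
by case: l => x [] /=; rewrite /eval_letter /= ?mulgV ?mulVg.
Qed.

Lemma eval_reduce w :
  (\prod_(l <- reduce w) eval_letter l = \prod_(l <- w) eval_letter l)%g.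
Proof.
elim: w => //= l w IHw; rewrite big_cons -IHw -/(reduce w).
case: (reduce w) => [|k v] /=; first by rewrite big_seq1 big_nil mulg1.
case: eqP => [->|_]; rewrite !big_cons //.
by rewrite mulgA eval_letter_inv mul1g.
Qed.

Lemma free_evalM u v : free_eval (u * v)%g = (free_eval u * free_eval v)%g.
Proof. by rewrite /free_eval eval_reduce big_cat. Qed.

Lemma free_eval1 : free_eval 1%g = 1%g.
Proof. exact: big_nil. Qed.

HB.instance Definition _ :=
  isMultiplicative.Build free_group G free_eval free_evalM.
HB.instance Definition _ :=
  Multiplicative_isUMagmaMorphism.Build free_group G free_eval free_eval1.

Lemma free_eval_gen x : free_eval (free_gen x) = f x.
Proof. by rewrite /free_eval big_seq1. Qed.

End FreeGroup.

Definition expgz (G : groupType) (x : G) (z : int) : G :=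
  match z with Posz m => (x ^+ m)%g | Negz m => (x ^- m.+1)%g end.

Definition subgroup_closed (G : groupType) (H : G -> Prop) : Prop :=
  H 1%g /\ forall x y, H x -> H y -> H (x * y^-1)%g.

Definition generates (G : groupType) (S : G -> Prop) : Prop :=
  forall H : G -> Prop,
    subgroup_closed H -> (forall s, S s -> H s) -> forall x, H x.

(* The free group on the two letters a, b, coded as false, true. *)
Notation F2 := (free_group bool).

Definition eval2 (G : groupType) (a b : G) (w : F2) : G :=
  free_eval (fun x : bool => if x then b else a) w.

Definition wa : F2 := free_gen false.
Definition wb : F2 := free_gen true.

Definition eps (n : nat) : int := (-1) ^+ n.-1.

(* Row, column and word indices below are natural numbers running from 1 to n;
   the values of the words outside that range are irrelevant. *)

Definition tau_step1 (r : nat) : F2 := (wa ^- r.-1 * wb * wa ^+ r.-1)%g.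

(* tau_diff d j is tau_(j + d, j), for d >= 1; the recursion is the one of
   tau_(i, j) := [tau_(i, j+1), tau_(j+1, j)] with d = i - j. *)
Fixpoint tau_diff (d j : nat) : F2 :=
  match d with
  | 0 => 1%g
  | 1 => tau_step1 j
  | d'.+1 => [~ tau_diff d' j.+1, tau_step1 j]%g
  end.

Definition tau_lower (i j : nat) : F2 := tau_diff (i - j) j.

Definition tau_1n (n : nat) : F2 :=
  expgz (wa ^- n.-1 * wb * wa ^+ n.-1)%g (eps n).

(* tau_last n i is tau_(i, n), for 1 <= i < n. *)
Definition tau_last (n i : nat) : F2 :=
  if i == 1 then tau_1n n else [~ tau_lower i 1, tau_1n n]%g.

Definition tau (n i j : nat) : F2 :=
  if (j < i)%N then tau_lower i j
  else if j == n then tau_last n i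
  else [~ tau_last n i, tau_lower n j]%g.

Section SpecialLinear.

Variable n : nat.

Record SL : Type := MkSL { SLmx :> 'M[int]_n; _ : \det SLmx == 1 }.

HB.instance Definition _ := [isSub for SLmx].
HB.instance Definition _ := [Choice of SL by <:].

Lemma SL_det (A : SL) : \det A = 1.
Proof. by case: A => A /= /eqP. Qed.

Lemma SL_unit (A : SL) : SLmx A \in unitmx.
Proof. by rewrite unitmxE SL_det unitr1. Qed.

Lemma SL1_subproof : \det (1%:M : 'M[int]_n) == 1.
Proof. by rewrite det1. Qed.

Lemma SLM_subproof (A B : SL) : \det (SLmx A *m SLmx B) == 1.
Proof. by rewrite det_mulmx !SL_det mulr1. Qed.

Lemma SLV_subproof (A : SL) : \det (invmx A) == 1.
Proof. by rewrite det_inv SL_det invr1. Qed.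

Definition SL1 : SL := MkSL SL1_subproof.
Definition SLM (A B : SL) : SL := MkSL (SLM_subproof A B).
Definition SLV (A : SL) : SL := MkSL (SLV_subproof A).

Lemma SLMA : associative SLM.
Proof. by move=> A B C; apply: val_inj; rewrite /= mulmxA. Qed.

Lemma SLM1l : left_id SL1 SLM.
Proof. by move=> A; apply: val_inj; rewrite /= mul1mx. Qed.

Lemma SLM1r : right_id SL1 SLM.
Proof. by move=> A; apply: val_inj; rewrite /= mulmx1. Qed.

Lemma SLMVl : left_inverse SL1 SLV SLM.
Proof. by move=> A; apply: val_inj; rewrite /= mulVmx ?SL_unit. Qed.

Lemma SLMVr : right_inverse SL1 SLV SLM.
Proof. by move=> A; apply: val_inj; rewrite /= mulmxV ?SL_unit. Qed.

HB.instance Definition _ := isGroup.Build SL SLMA SLM1l SLM1r SLMVl SLMVr.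

Definition Emx (i j : nat) : 'M[int]_n :=
  \matrix_(k, l) ((k.+1 == i) && (l.+1 == j))%:R.

Lemma Emx_delta (i j : 'I_n) : Emx i.+1 j.+1 = delta_mx i j.
Proof. by apply/matrixP=> k l; rewrite !mxE !eqSS. Qed.

Definition Tmx (i j : nat) : 'M[int]_n := 1%:M + Emx i j.

Definition amx : 'M[int]_n :=
  \sum_(1 <= i < n) Emx i i.+1 + eps n *: Emx n 1.

Definition bmx : 'M[int]_n := 1%:M + Emx 2 1.

Lemma amxE (k l : 'I_n) :
  amx k l = (l == k.+1 :> nat)%:R + eps n * ((k.+1 == n) && (l == 0 :> nat))%:R.
Proof.
rewrite !mxE eqSS summxE; congr (_ + _).
rewrite (eq_bigr (fun i => ((k.+1 == i) && (l.+1 == i.+1))%:R)); last first.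
  by move=> i _; rewrite mxE.
case: (eqVneq (l : nat) k.+1) => [e|ne].
  rewrite (bigD1_seq k.+1) ?iota_uniq //=; last first.
    by rewrite mem_index_iota /= -e ltn_ord.
  rewrite eqxx e eqxx big1 ?addr0 // => i /negPf ni.
  by rewrite eq_sym ni.
rewrite big1 // => i _; case: (eqVneq k.+1 i) => [<-|//].
by rewrite eqSS (negPf ne).
Qed.

End SpecialLinear.

Lemma det_amx n : \det (amx n) == 1.
Proof.
case: n => [|m]; first by rewrite det_mx00.
rewrite (expand_det_col _ ord0) (bigD1 ord_max) //= big1 ?addr0; last first.
  move=> i ni; rewrite amxE /= eqSS.
  by rewrite (negPf (_ : i != m :> nat)) // mulr0 add0r mul0r.
rewrite amxE /= !eqxx /= mulr1 add0r /cofactor addn0.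
rewrite (_ : row' _ _ = 1%:M) ?det1 ?mulr1 /eps /= ?signrMK -?exprD ?addnn.
  by rewrite -mul2n exprM sqrrN expr1n.
apply/matrixP=> i j; rewrite [LHS]mxE [LHS]mxE amxE [RHS]mxE /=.
by rewrite /bump /= leqNgt ltn_ord /= add0n !add1n !eqSS andbF mulr0 addr0 eq_sym.
Qed.

Lemma det_bmx n : \det (bmx n) == 1.
Proof.
rewrite det_trig.
  rewrite big1 // => i _; rewrite !mxE eqxx.
  by case: i => [[|[|i]] ?].
apply/is_trig_mxP => i j ij; rewrite !mxE.
case: eqP ij => [->|_]; first by rewrite ltnn.
by case: i j => [[|[|i]] ?] [[|[|j]] ?].
Qed.

Definition aSL (n : nat) : SL n := MkSL (det_amx n).
Definition bSL (n : nat) : SL n := MkSL (det_bmx n).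

(* Main.v *)
Require Import Defs.
From mathcomp Require Import all_boot all_order all_fingroup all_algebra.
From mathcomp Require Import zify.

Set Implicit Arguments.
Unset Strict Implicit.
Unset Printing Implicit Defensive.

Import Order.TTheory GRing.Theory Num.Theory.
Local Open Scope ring_scope.

(** Both halves of the statement live on the transvections 1 + c E_ij, which
    are treated for arbitrary integers c: for fixed i <> j they form a copy of
    the additive group of the integers, and [1 + c E_ij, 1 + d E_jk] is
    1 + c d E_ik when i, j, k are distinct.

    The words. The matrix a sends each basis row e_j to e_(j+1), except that
    e_n goes to eps e_1; hence conjugation by a moves the entry of E_ij one
    step down the diagonal (SLmx_conj_a), and from the last row it wraps
    around to the first one with the sign eps (SLmx_conj_a_last). Starting from
    b = 1 + E_21 this produces the whole subdiagonal 1 + E_(r+1,r), then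
    1 + eps E_1n, whose power eps is 1 + E_1n because eps^2 = 1. All the other
    words are commutators to which the relation above applies with c = d = 1,
    the middle index being j+1, 1 or n (SLmx_tau).

    Generation. A subgroup that contains a and b contains the values of all the
    words, so all integral transvections, so it is enough that these generate
    SL_n(Z). This is Gaussian elimination over the Euclidean ring Z
    (row_reduction). The columns are made standard from left to right; in
    column k only rows k and below serve as sources, which protects the columns
    already treated. Euclid's algorithm leaves one nonzero entry among those
    rows, and it is a unit because the matrix is invertible. If it is off the
    diagonal, or if there is still a row below k, row operations turn it into a
    1 on the diagonal; in the last column the determinant forces that 1. *)

(** * Transvections *)

Section Transvections.

Variable n : nat.

Definition transv (i j : nat) (c : int) : 'M[int]_n := 1%:M + c *: Emx n i j.

Lemma transv1 i j : transv i j 1 = Tmx n i j.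
Proof. by rewrite /transv scale1r. Qed.

Lemma mul_Emx i j l :
  (1 <= j <= n)%N -> Emx n i j *m Emx n j l = Emx n i l.
Proof.
case: j => // j /andP[_ jn]; apply/matrixP=> p q; rewrite !mxE.
rewrite (bigD1 (Ordinal jn)) //= big1 => [|r /negPf nr]; last first.
  rewrite !mxE !eqSS (_ : (r == j :> nat) = false) ?andbF ?mul0r //.
by rewrite !mxE !eqxx andbT /= addr0; case: eqP; rewrite ?mul1r ?mul0r.
Qed.

Lemma mul_Emx_0 i j k l : j != k -> Emx n i j *m Emx n k l = 0.
Proof.
move=> njk; apply/matrixP=> p q; rewrite !mxE big1 // => r _; rewrite !mxE.
by case: (r.+1 =P j) => [->|]; rewrite ?andbF ?mul0r // (negPf njk) mulr0.
Qed.

Lemma transvD i j c d : i != j ->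
  transv i j (c + d) = transv i j c *m transv i j d.
Proof.
move=> nij; rewrite /transv mulmxDr mulmx1 mulmxDl mul1mx.
rewrite -scalemxAl -scalemxAr mul_Emx_0 1?eq_sym // !scaler0 addr0.
by rewrite scalerDl addrA.
Qed.

Lemma transv0 i j : transv i j 0 = 1%:M.
Proof. by rewrite /transv scale0r addr0. Qed.

Lemma transv_mulE (i j : 'I_n) c (M : 'M_n) p q :
  (transv i.+1 j.+1 c *m M) p q = M p q + (p == i)%:R * (c * M j q).
Proof.
rewrite mulmxDl mul1mx mxE -scalemxAl Emx_delta; congr (_ + _).
rewrite !mxE (bigD1 j) //= big1 => [|r /negPf nr]; rewrite !mxE.
  by rewrite eqxx andbT addr0 mulrCA.
by rewrite nr andbF mul0r.
Qed.

(** A transvection is unitriangular, below or above the diagonal. *)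
Lemma det_transv (i j : 'I_n) c : i != j -> \det (transv i.+1 j.+1 c) = 1.
Proof.
suff trig (k l : 'I_n) : (l < k)%N -> \det (transv k.+1 l.+1 c) = 1.
  rewrite neq_ltn => /orP[ij|/trig//].
  rewrite -det_tr -(trig _ _ ij); congr (\det _); apply/matrixP=> p q.
  by rewrite /transv !Emx_delta !mxE (eq_sym q) andbC.
move=> lk; rewrite det_trig; last first.
  apply/is_trig_mxP=> p q pq; rewrite /transv Emx_delta !mxE.
  rewrite -val_eqE /= ltn_eqF // add0r; case: eqP => [pk|] /=; last by rewrite mulr0.
  case: eqP => [ql|]; last by rewrite mulr0.
  by move: pq; rewrite pk ql ltnNge ltnW.
rewrite big1 // => p _; rewrite /transv Emx_delta !mxE eqxx.
case: eqP => [->|]; last by rewrite mulr0 addr0.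
by rewrite -val_eqE /= gtn_eqF // mulr0 addr0.
Qed.

(** * Commutators and conjugation in SL_n(Z) *)

Lemma SLmx_mul (x y : SL n) : SLmx (x * y)%g = SLmx x *m SLmx y.
Proof. by []. Qed.

Lemma SL_mulI (x : SL n) (A B : 'M_n) : SLmx x *m A = SLmx x *m B -> A = B.
Proof. by move/(congr1 (mulmx (invmx x))); rewrite !mulKmx ?SL_unit. Qed.

(** The values of conjugates and commutators are read off the relations
    x y = y (x ^ y) and x y = y x [x, y], which involve no inverse matrix. *)
Lemma SLmx_conj (x y : SL n) (A : 'M_n) :
  SLmx x *m SLmx y = SLmx y *m A -> SLmx (x ^ y)%g = A.
Proof. by move=> e; apply: (@SL_mulI y); rewrite -e -!SLmx_mul -conjgC. Qed.

(** Expanding (1 + c E_ij) (1 + d E_jk) gives one quadratic term c d E_ik,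
    which is absent from the product in the other order since k <> i. *)
Lemma SLmx_comm_transv (x y : SL n) i j k c d :
    (1 <= j <= n)%N -> i != j -> j != k -> i != k ->
    SLmx x = transv i j c -> SLmx y = transv j k d ->
  SLmx [~ x, y]%g = transv i k (c * d).
Proof.
move=> jn nij njk nik ex ey; apply: (@SL_mulI (y * x)%g).
rewrite -SLmx_mul -commgC !SLmx_mul ex ey /transv.
rewrite !(mulmxDl, mulmxDr, mul1mx, mulmx1) -!(scalemxAl, scalemxAr).
rewrite mul_Emx // !(@mul_Emx_0 j k) 1?eq_sym // !(@mul_Emx_0 i j) 1?eq_sym //.
by rewrite !mul0mx !(scaler0, addr0) scalerA -!addrA; congr (_ + _); rewrite addrCA.
Qed.

(** A matrix unit selects a row of a when it stands on the left and a column of a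
    when it stands on the right; each has a single nonzero entry, so that a
    acts on matrix units by shifting an index, up to the sign in the corner. *)
Lemma Emx_amx i j : (1 <= j < n)%N -> Emx n i j *m amx n = Emx n i j.+1.
Proof.
move=> jn; rewrite /amx mulmxDr mulmx_sumr -scalemxAr.
rewrite mul_Emx_0 ?scaler0 ?addr0; last by rewrite ltn_eqF //; case/andP: jn.
rewrite (bigD1_seq j) ?iota_uniq ?mem_index_iota //=.
rewrite mul_Emx; last by case/andP: jn => -> /ltnW.
by rewrite big1 ?addr0 // => k nk; rewrite mul_Emx_0 1?eq_sym.
Qed.

Lemma amx_Emx i j : (1 <= i < n)%N -> amx n *m Emx n i.+1 j = Emx n i j.
Proof.
move=> iN; rewrite /amx mulmxDl mulmx_suml -scalemxAl.
rewrite mul_Emx_0 ?scaler0 ?addr0; last by rewrite ltn_eqF //; case/andP: iN.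
rewrite (bigD1_seq i) ?iota_uniq ?mem_index_iota //=.
rewrite mul_Emx; last by case/andP: iN.
by rewrite big1 ?addr0 // => k nk; rewrite mul_Emx_0 // eqSS.
Qed.

Lemma amx_Emx1 j : (0 < n)%N -> amx n *m Emx n 1 j = eps n *: Emx n n j.
Proof.
move=> n0; rewrite /amx mulmxDl mulmx_suml -scalemxAl mul_Emx ?n0 //.
rewrite big_nat big1 ?add0r // => k /andP[k0 _].
by rewrite mul_Emx_0 // gtn_eqF.
Qed.

Lemma eps_sqr : eps n * eps n = 1.
Proof. by rewrite /eps -exprD addnn -mul2n exprM sqrrN !expr1n. Qed.

Lemma SLmx_conj_a (x : SL n) i j c : (1 <= i < n)%N -> (1 <= j < n)%N ->
  SLmx x = transv i j c -> SLmx (x ^ aSL n)%g = transv i.+1 j.+1 c.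
Proof.
move=> iN jN ex; apply: SLmx_conj; rewrite ex /= /transv mulmxDl mulmxDr.
by rewrite mul1mx mulmx1 -scalemxAl -scalemxAr Emx_amx ?amx_Emx.
Qed.

(** Both (1 + E_nj) a and a (1 + eps E_(1,j+1)) are equal to a + E_(n,j+1), the
    latter because eps occurs twice. *)
Lemma SLmx_conj_a_last (x : SL n) j : (1 <= j < n)%N ->
  SLmx x = transv n j 1 -> SLmx (x ^ aSL n)%g = transv 1 j.+1 (eps n).
Proof.
move=> jN ex; apply: SLmx_conj; rewrite ex /= /transv mulmxDl mulmxDr.
rewrite mul1mx mulmx1 -scalemxAl -scalemxAr Emx_amx // amx_Emx1 //.
  by rewrite scalerA eps_sqr.
by case/andP: jN => j0 /(leq_ltn_trans (leq0n j)).
Qed.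

Lemma SLmx_inv_transv (x : SL n) i j c : i != j ->
  SLmx x = transv i j c -> SLmx x^-1%g = transv i j (- c).
Proof.
move=> nij ex; apply: (@SL_mulI x); rewrite -SLmx_mul mulgV.
by rewrite ex -transvD // subrr transv0.
Qed.

Lemma SLmx_expgz_transv (x : SL n) i j c z : i != j ->
  SLmx x = transv i j c -> SLmx (expgz x z) = transv i j (c * z).
Proof.
move=> nij ex.
have X m : SLmx (x ^+ m)%g = transv i j (c * m%:Z).
  elim: m => [|m IHm]; first by rewrite mulr0 transv0.
  by rewrite expgS SLmx_mul IHm ex -transvD // -{1}[c]mulr1 -mulrDr.
case: z => m /=; first exact: X.
by rewrite NegzE mulrN; apply: SLmx_inv_transv.
Qed.

(** * The values of the words *)

Local Notation ev := (eval2 (aSL n) (bSL n)).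

Lemma ev_conj r :
  ev (wa ^- r * wb * wa ^+ r)%g = (bSL n ^ (aSL n ^+ r))%g.
Proof.
rewrite -mulgA -[(_ * _)%g]/(wb ^ (wa ^+ r))%g /eval2.
rewrite gmulfJ gmulfXn /=; congr (_ ^ (_ ^+ _))%g; exact: free_eval_gen.
Qed.

Lemma SLmx_step1 r : (r.+1 < n)%N ->
  SLmx (ev (tau_step1 r.+1)) = transv r.+2 r.+1 1.
Proof.
rewrite /tau_step1 ev_conj -[r.+1.-1]/r; elim: r => [|r IHr] rn.
  by rewrite expg0 conjg1 /= /bmx /transv scale1r.
by rewrite expgSr conjgM; apply: SLmx_conj_a (IHr (ltnW rn)); last exact: ltnW.
Qed.

(** One more conjugation than for the last subdiagonal entry wraps around to
    1 + eps E_1n; the exponent eps of the word squares the sign away. *)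
Lemma SLmx_tau_1n : (2 <= n)%N -> SLmx (ev (tau_1n n)) = transv 1 n 1.
Proof.
move=> n2; rewrite -eps_sqr /tau_1n.
have expev (x : F2) z : ev (expgz x z) = expgz (ev x) z.
  by case: z => m; rewrite /eval2 /= ?gmulfV gmulfXn.
rewrite expev; apply: SLmx_expgz_transv; first by rewrite ltn_eqF.
have [m def_n]: {m | n = m.+2} by exists n.-2; case: n n2 => [|[]].
have en: n.-1 = m.+1 by rewrite def_n.
rewrite ev_conj en expgSr conjgM.
rewrite [X in transv _ X](_ : n = m.+2) //.
apply: SLmx_conj_a_last; first by rewrite def_n ltnSn.
rewrite -ev_conj -[m]/(m.+1.-1) -/(tau_step1 m.+1) SLmx_step1; last by rewrite def_n.
by congr (transv _ _ _).
Qed.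

Lemma SLmx_tau_diff d j : (0 < j)%N -> (j + d.+1 <= n)%N ->
  SLmx (ev (tau_diff d.+1 j)) = transv (j + d.+1) j 1.
Proof.
elim: d j => [|d IHd] [//|j] _ jn.
  by rewrite addn1 SLmx_step1 // -addn1.
rewrite -[tau_diff _ _]/[~ tau_diff d.+1 j.+2, tau_step1 j.+1]%g.
rewrite /eval2 gmulfR -[1]mulr1 -addSnnS.
apply: (@SLmx_comm_transv _ _ _ j.+2); rewrite ?IHd ?SLmx_step1 //; lia.
Qed.

Lemma SLmx_tau_lower i j : (0 < j)%N -> (j < i <= n)%N ->
  SLmx (ev (tau_lower i j)) = transv i j 1.
Proof.
move=> j0 /andP[ji iN]; rewrite /tau_lower -{2}(subnKC (ltnW ji)).
have: (0 < i - j)%N by rewrite subn_gt0.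
have := subnKC (ltnW ji); case: (i - j)%N => // d e _.
by apply: SLmx_tau_diff; rewrite ?e.
Qed.

Lemma SLmx_tau_last i : (0 < i < n)%N ->
  SLmx (ev (tau_last n i)) = transv i n 1.
Proof.
move=> /andP[i0 iN]; have n2: (2 <= n)%N by apply: leq_ltn_trans iN.
rewrite /tau_last; case: eqP => [->|/eqP ni1]; first exact: SLmx_tau_1n.
rewrite /eval2 gmulfR -[1]mulr1; apply: (@SLmx_comm_transv _ _ _ 1);
  rewrite ?SLmx_tau_lower ?SLmx_tau_1n //; lia.
Qed.

Lemma SLmx_tau i j : (1 <= i <= n)%N -> (1 <= j <= n)%N -> i <> j ->
  SLmx (ev (tau n i j)) = transv i j 1.
Proof.
move=> /andP[i0 iN] /andP[j0 jN] /eqP nij; rewrite /tau.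
case: (ltngtP j i) nij => // [ji|ij] _; first by apply: SLmx_tau_lower; rewrite ?ji.
have in' := leq_trans ij jN.
case: eqP => [->|/eqP njn]; first by apply: SLmx_tau_last; rewrite i0.
rewrite /eval2 gmulfR -[1]mulr1; apply: (@SLmx_comm_transv _ _ _ n);
  rewrite ?SLmx_tau_last ?SLmx_tau_lower //; lia.
Qed.

End Transvections.

(** * Integral row reduction *)

Section RowReduction.

Variables (n : nat) (P : 'M[int]_n -> Prop).
Hypothesis P1 : P 1%:M.
Hypothesis P_transv : forall (i j : 'I_n) c M,
  i != j -> P (transv n i.+1 j.+1 c *m M) -> P M.

Definition unit_cols k (M : 'M[int]_n) :=
  forall i j : 'I_n, (j < k)%N -> M i j = (i == j)%:R.

Lemma unit_cols_transv k (i j : 'I_n) c M : (k <= j)%N ->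
  unit_cols k M -> unit_cols k (transv n i.+1 j.+1 c *m M).
Proof.
move=> kj Mk p q qk; rewrite transv_mulE !Mk //.
have /negPf-> : j != q by rewrite -val_eqE /= gtn_eqF // (leq_trans qk).
by rewrite !mulr0 addr0.
Qed.

Lemma det_transv_mul (i j : 'I_n) c (M : 'M_n) :
  i != j -> \det (transv n i.+1 j.+1 c *m M) = \det M.
Proof. by move=> nij; rewrite det_mulmx det_transv // mul1r. Qed.

(** Since the first k columns of M are standard, so are those of its inverse N;
    thus in the (k, k) entry of N M = 1 only rows k and below contribute, and
    the single nonzero one among them gives N k p * M p k = 1. The conclusion is
    the form of invertibility in Z that the row operations use. *)
Lemma pivot_unit (k p : 'I_n) M : \det M = 1 -> unit_cols k M ->
    (forall i : 'I_n, (k <= i)%N -> i != p -> M i k = 0) ->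
  M p k * M p k = 1.
Proof.
move=> dM Mk Mp; pose N := invmx M.
have NM : N *m M = 1%:M by rewrite mulVmx // unitmxE dM unitr1.
have N0 (j : 'I_n) : (j < k)%N -> N k j = 0.
  move=> jk; have := congr1 (fun A : 'M_n => A k j) NM; rewrite !mxE.
  have /negPf-> : k != j by rewrite -val_eqE /= gtn_eqF.
  rewrite (bigD1 j) //= Mk // eqxx mulr1 big1 ?addr0 // => i nij.
  by rewrite Mk // (negPf nij) mulr0.
have := congr1 (fun A : 'M_n => A k k) NM; rewrite !mxE eqxx.
rewrite (bigD1 p) //= big1 ?addr0; last first.
  by move=> i nip; case: (ltnP i k) => ik; [rewrite N0 ?mul0r | rewrite Mp ?mulr0].
by case/intUnitRing.unitzPl/orP=> /eqP->.
Qed.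

(** With a 1 on the diagonal, the other entries of the column, also the ones in
    the rows above, are killed one at a time. *)
Lemma clear_column (k : 'I_n) :
    (forall M, \det M = 1 -> unit_cols k.+1 M -> P M) ->
  forall M, \det M = 1 -> unit_cols k M -> M k k = 1 -> P M.
Proof.
move=> Pk M; move: {-1}#|_| (erefl #|[set i | (i != k) && (M i k != 0)]|) => m.
elim: m M => [|m IHm] M.
  move/cards0_eq=> M0 dM Mk Mkk; apply: Pk => // i j.
  rewrite ltnS leq_eqVlt => /orP[/eqP/val_inj->|/Mk//].
  case: eqVneq => [-> //|nik]; apply/eqP.
  by have := in_set0 i; rewrite -M0 inE nik => /negbFE.
move=> eM dM Mk Mkk; have [i] : exists i, i \in [set i | (i != k) && (M i k != 0)].
  by apply/set0Pn; rewrite -cards_eq0 eM.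
move=> iM; have /[!inE]/andP[nik _] := iM.
apply: (P_transv (c := - M i k) nik); apply: IHm.
- apply/eqP; rewrite -eqSS -eM.
  rewrite (cardsD1 i [set i | (i != k) && (M i k != 0)]) iM add1n eqSS; apply/eqP.
  apply: eq_card => p; rewrite !inE transv_mulE Mkk mulr1.
  case: (eqVneq p i) => [->|npi] /=; first by rewrite mul1r subrr eqxx andbF.
  by rewrite mul0r addr0.
- by rewrite det_transv_mul.
- exact: unit_cols_transv.
- by rewrite transv_mulE eq_sym (negPf nik) mul0r addr0.
Qed.

(** A unit u in row p <> k yields a 1 in row k by adding u times row p. When
    p = k, the same is done through an auxiliary row q > k: u times row k puts
    u^2 = 1 in row q, and 1 - u times row q turns the diagonal entry into
    u + (1 - u) = 1. Without a row q, the matrix is triangular with diagonal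
    1, ..., 1, u, so that u is its determinant. *)
Lemma unit_pivot_reduction (k p : 'I_n) M :
    (forall M, \det M = 1 -> unit_cols k.+1 M -> P M) ->
    \det M = 1 -> unit_cols k M -> (k <= p)%N ->
    (forall i : 'I_n, (k <= i)%N -> i != p -> M i k = 0) -> P M.
Proof.
move=> Pk dM Mk kp Mp; have u2 := pivot_unit dM Mk Mp.
have [epk|npk] := eqVneq p k; last first.
  have nkp : k != p by rewrite eq_sym.
  apply: (P_transv (c := M p k) nkp); apply: (clear_column Pk) => //.
  - by rewrite det_transv_mul.
  - exact: unit_cols_transv.
  - by rewrite transv_mulE eqxx mul1r u2 Mp // add0r.
rewrite {p}epk in kp Mp u2.
have last_or_one : (exists q : 'I_n, k < q)%N \/ M k k = 1.
  have [kn|nk] := ltnP k.+1 n; first by left; exists (Ordinal kn).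
  right; rewrite -dM -det_tr det_trig; last first.
    apply/is_trig_mxP=> i j ij; rewrite mxE Mk; last by have := ltn_ord j; lia.
    by rewrite -val_eqE /= gtn_eqF.
  rewrite (bigD1 k) //= mxE big1 ?mulr1 // => i nik; rewrite mxE Mk ?eqxx //.
  have := ltn_ord i; move: nik; rewrite -val_eqE /=; lia.
case: last_or_one => [[q kq]|Mkk]; last exact: (clear_column Pk).
have nqk : q != k by rewrite -val_eqE /= gtn_eqF.
have nkq : k != q by rewrite eq_sym.
have kq' := ltnW kq.
apply: (P_transv (c := M k k) nqk); apply: (P_transv (c := 1 - M k k) nkq).
apply: (clear_column Pk) => //.
- by rewrite !det_transv_mul.
- by do 2!apply: unit_cols_transv => //.
- rewrite !transv_mulE !eqxx (negPf nkq) (Mp q) // u2 mul0r addr0 add0r !mul1r mulr1.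
  by rewrite addrC subrK.
Qed.

(** Euclid's algorithm: of two nonzero entries in rows k and below, the larger
    one is replaced by its remainder modulo the smaller one, which decreases the
    sum of the absolute values over these rows. *)
Lemma column_step (k : 'I_n) :
    (forall M, \det M = 1 -> unit_cols k.+1 M -> P M) ->
  forall M, \det M = 1 -> unit_cols k M -> P M.
Proof.
move=> Pk M.
have [m] := ubnP (\sum_(i < n | (k <= i)%N) `|M i k|%N).
elim: m M => // m IHm M; rewrite ltnS => leMm dM Mk.
have reduce (p q : 'I_n) : p != q -> (k <= p)%N -> (k <= q)%N ->
    M p k != 0 -> (`|M p k| <= `|M q k|)%N -> P M.
  move=> npq kp kq Mp0 lepq; have nqp : q != p by rewrite eq_sym.
  apply: (P_transv (c := - (M q k %/ M p k)%Z) nqp); apply: IHm.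
  - apply: leq_trans leMm.
    rewrite (bigD1 q) //= [X in (_ < X)%N](bigD1 q) //= -addSn.
    apply: leq_add.
      rewrite transv_mulE eqxx mul1r mulNr.
      rewrite [X in X - _](divz_eq (M q k) (M p k)) addrC addKr.
      apply: leq_trans lepq; have := ltz_mod (M q k) Mp0.
      have := modz_ge0 (M q k) Mp0; lia.
    apply/eq_leq/eq_bigr => i /andP[_ niq].
    by rewrite transv_mulE (negPf niq) mul0r addr0.
  - by rewrite det_transv_mul.
  - exact: unit_cols_transv.
(* A zero column is treated as having its pivot on the diagonal: the invertibility
   argument of pivot_unit excludes it. *)
have [p /andP[kp Mp0]|M0] :=
    pickP (fun p : 'I_n => (k <= p)%N && (M p k != 0)); last first.
  apply: (@unit_pivot_reduction k k) => // i ki _; apply/eqP.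
  by have := M0 i; rewrite /= ki => /negbFE.
have [q /and3P[kq nqp Mq0]|Mp] :=
    pickP (fun q : 'I_n => [&& (k <= q)%N, q != p & M q k != 0]).
  case: (leqP `|M p k|%N `|M q k|%N) => [|/ltnW]; apply: reduce => //.
  by rewrite eq_sym.
apply: (@unit_pivot_reduction k p) => // i ki nip; apply/eqP.
by have := Mp i; rewrite /= ki nip => /negbFE.
Qed.

(** That transvections generate SL_n(Z) is put in the form of an induction
    principle: P is meant to say that M is the matrix of an element of a given
    subgroup, and its stability under undoing a row operation is all that the
    subgroup has to provide. *)
Theorem row_reduction M : \det M = 1 -> P M.
Proof.
(* d is the number of columns that remain to be treated. *)
suff red d : (d <= n)%N -> forall M, \det M = 1 -> unit_cols (n - d) M -> P M.
  by move=> dM; apply: (red n); rewrite ?subnn.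
elim: d => [_ {}M _ Mn|d IHd dn].
  suff -> : M = 1%:M by [].
  by apply/matrixP=> i j; rewrite Mn ?subn0 ?mxE.
have kn : (n - d.+1 < n)%N by lia.
apply: (@column_step (Ordinal kn)) => /=.
by rewrite -subSn // subSS; apply: IHd; apply: ltnW.
Qed.

End RowReduction.

(** * Generation of SL_n(Z) by a and b *)

Theorem theorem2p8 (n : nat) (n_ge3 : (3 <= n)%N) :
  (forall i j : nat,
     (1 <= i <= n)%N -> (1 <= j <= n)%N -> i <> j ->
     SLmx (eval2 (aSL n) (bSL n) (tau n i j)) = Tmx n i j)
  /\ generates (fun g : SL n => g = aSL n \/ g = bSL n).
Proof.
have tauE i j : (1 <= i <= n)%N -> (1 <= j <= n)%N -> i <> j ->
    SLmx (eval2 (aSL n) (bSL n) (tau n i j)) = transv n i j 1.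
  by apply: SLmx_tau.
split=> [i j iN jN nij|]; first by rewrite tauE // transv1.
move=> H [H1 HF] Hab.
have HV x : H x -> H x^-1%g by move=> Hx; rewrite -[x^-1%g]mul1g; apply: HF.
have HM x y : H x -> H y -> H (x * y)%g.
  by move=> Hx Hy; rewrite -[y]invgK; apply: HF => //; apply: HV.
have HX x m : H x -> H (x ^+ m)%g.
  by move=> Hx; elim: m => [|m IHm]; rewrite ?expgS //; apply: HM.
have Hev w : H (eval2 (aSL n) (bSL n) w).
  apply: big_ind => // -[[] []] _; rewrite /eval_letter /=; try apply: HV;
    by apply: Hab; auto.
move=> x; suff [y Hy <-] : exists2 y, H y & y = x by [].
suff: exists2 y : SL n, H y & SLmx y = SLmx x.
  by case=> y Hy /val_inj eyx; exists y.
apply: (@row_reduction n (fun M => exists2 y, H y & SLmx y = M)); last exact: SL_det.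
  by exists 1%g.
move=> i j c M nij [y Hy ey].
pose t := eval2 (aSL n) (bSL n) (tau n i.+1 j.+1).
have et : SLmx (expgz t (- c)) = transv n i.+1 j.+1 (- c).
  rewrite -[X in transv _ _ _ X]mul1r; apply: SLmx_expgz_transv => //.
  by apply: tauE; rewrite ?ltn_ord //; apply/eqP.
exists (expgz t (- c) * y)%g.
  by apply: HM => //; case: (- c) => m; [|apply: HV]; apply: HX; apply: Hev.
by rewrite SLmx_mul ey et mulmxA -transvD // addNr transv0 mul1mx.
Qed.
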